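(* Let $H\in\mathbb{R}^{n\times n}$ be symmetric positive definite, $b\in\mathbb{R}^n$, and $f(x)=\frac12 x^{\mathrm T}Hx+b^{\mathrm T}x$. Let $x_0\in\mathbb{R}^n$ and $\alpha_0>0$. In exact arithmetic, the sequence $\{x_k\}$ generated from $(x_0,\alpha_0)$ by $x_{k+1}=x_k-\alpha_k G(x_k)$ with the short KGD step-size $\alpha_{k+1}=\mathcal{K}_1^{\rm s}(x_{k+1};x_k,\alpha_k)$ and the sequence generated from the same $(x_0,\alpha_0)$ by $x_{k+1}=x_k-\alpha_kG(x_k)$ with the short Barzilai–Borwein step-size $\alpha_{k+1}=\alpha_{k+1}^{\rm BB2}$ are the same. Furthermore, $\{x_k\}$ converges to the minimizer $x^*=-H^{-1}b$ of $f$ at least (R-)linearly with rate $1-\frac1\kappa$, where $\kappa$ is the condition number of $H$.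
   Context: $G(x)=\nabla f(x)=Hx+b$, and $\|\cdot\|_2$ is the Euclidean norm. The condition number is $\kappa=\lambda_{\max}(H)/\lambda_{\min}(H)\ge 1$. Short KGD step-size: for $\alpha>0$ and $x_{\rm new}=x-\alpha G(x)$, $$\mathcal{K}_1^{\rm s}(x_{\rm new};x,\alpha)=\frac{2\left(\alpha\|G(x)\|_2^2+f(x_{\rm new})-f(x)\right)}{\|G(x_{\rm new})-G(x)\|_2^2}.$$ Short Barzilai–Borwein step-size: with $s_k=x_{k+1}-x_k$ and $y_k=G(x_{k+1})-G(x_k)$, $$\alpha^{\rm BB2}_{k+1}=\frac{s_k^{\mathrm T}y_k}{y_k^{\mathrm T}y_k}.$$ If $G(x_k)=0$ for some $k$, then $x_k=x^*$ and the iteration stops; the sequence is then regarded as constant equal to $x^*$ from that index on. A sequence $x_k\to x^*$ converges at least (R-)linearly with rate $\varrho\in[0,1)$ if there exist $C>0$ and $k_0$ such that $\|x_k-x^*\|_2\le C\varrho^k$ for all $k\ge k_0$. *)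

(* Defs.v *)
From HB Require Import structures.
From mathcomp Require Import all_boot all_order all_algebra.
From mathcomp Require Import all_classical all_reals all_analysis.

Set Implicit Arguments.
Unset Strict Implicit.
Unset Printing Implicit Defensive.

Import Order.TTheory GRing.Theory Num.Theory.
Import numFieldNormedType.Exports.

Local Open Scope classical_set_scope.
Local Open Scope ring_scope.

Section Definitions.
Context {R : realType} {n : nat}.
Implicit Types (H : 'M[R]_n) (b x y s : 'cV[R]_n) (alpha rho : R).

Definition dot x y : R := (x^T *m y) 0 0.

(* The norm that MathComp-Analysis puts on matrices is the sup norm. *)
Definition norm2 x : R := Num.sqrt (\sum_(i < n) x i 0 ^+ 2).

Definition posdefmx H : Prop :=
  H^T = H /\ forall x, x != 0 -> 0 < dot x (H *m x).

(* [eigenvalue] refers to row eigenvectors, which is immaterial for symmetric H.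
   For H symmetric and 0 < n the spectrum is finite and nonempty, so that the
   supremum and the infimum are attained. *)
Definition lambda_max H : R := sup [set a | eigenvalue H a].
Definition lambda_min H : R := inf [set a | eigenvalue H a].

Definition cond_number H : R := lambda_max H / lambda_min H.

Definition quad H b x : R := 2^-1 * dot x (H *m x) + dot b x.

Definition grad H b x : 'cV[R]_n := H *m x + b.

Definition is_minimizer (f : 'cV[R]_n -> R) x : Prop := forall y, f x <= f y.

Definition kgd_short H b xnew x alpha : R :=
  2 * (alpha * norm2 (grad H b x) ^+ 2 + quad H b xnew - quad H b x)
    / norm2 (grad H b xnew - grad H b x) ^+ 2.

(* The last argument is unused; it gives both rules the same type. *)
Definition bb_short H b xnew x alpha : R :=
  let s := xnew - x in
  let y := grad H b xnew - grad H b x in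
  dot s y / dot y y.

(* The iteration stops, and stays constant, once the gradient vanishes; no
   step-size is computed from a zero gradient difference. *)
Definition gd_step H b (rule : 'cV[R]_n -> 'cV[R]_n -> R -> R)
    (st : 'cV[R]_n * R) : 'cV[R]_n * R :=
  let: (x, alpha) := st in
  if grad H b x == 0 then st
  else let xnew := x - alpha *: grad H b x in (xnew, rule xnew x alpha).

Definition gd_seq H b rule x0 alpha0 (k : nat) : 'cV[R]_n :=
  (iter k (gd_step H b rule) (x0, alpha0)).1.

Definition cvg_Rlinear (x : nat -> 'cV[R]_n) (xs : 'cV[R]_n) rho : Prop :=
  [/\ 0 <= rho < 1,
      (fun k => norm2 (x k - xs)) @ \oo --> (0 : R)
    & exists C : R, 0 < C /\ exists k0 : nat,
        forall k : nat, (k0 <= k)%N -> norm2 (x k - xs) <= C * rho ^+ k].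

End Definitions.

(* Main.v *)
Require Import Defs.
From mathcomp Require Import all_boot all_order all_algebra.
From mathcomp Require Import all_classical all_reals all_analysis.
From mathcomp Require Import ring lra.
From mathcomp Require Import spectral sesquilinear complex.
Set Implicit Arguments.
Unset Strict Implicit.
Unset Printing Implicit Defensive.

Import Order.TTheory GRing.Theory Num.Theory.
Import numFieldNormedType.Exports.

Local Open Scope classical_set_scope.
Local Open Scope ring_scope.

(* Both step-sizes equal s^T H s / |H s|^2 because f is quadratic. In an
   eigenbasis of H, mode i of the gradient is multiplied by 1 - alpha_k lambda_i
   at step k, and 1 / alpha_{k+1} is the mean of the eigenvalues with weights
   lambda_j g_{k,j}^2. By induction on the size of lambda_i, mode i is
   O(theta^k) with theta = 1 - 1/kappa: as long as mode i is large compared with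
   theta^k, it dominates the modes of smaller eigenvalue, so that the mean is at
   least lambda_i / (1 + theta) and the mode is contracted by theta; when it is
   small, it grows at most by a bounded factor before the contraction, delayed by
   one step, sets in. For theta = 0 all eigenvalues coincide and x_2 = x^*. *)

(** * Decay of the modes under an abstract scalar recursion *)

Section ModeDecay.
Context {R : realFieldType} {I : finType} {lam : I -> R} {L U : R}.
Context {w : nat -> I -> R} {a : nat -> R}.
Context (L_gt0 : 0 < L) (lam_bnd : forall i, L <= lam i <= U).
Context (w_ge0 : forall k i, 0 <= w k i).
Context (w_step : forall k i, w k.+1 i = `|1 - a k * lam i| * w k i).
(** The nonzero mode [i] witnesses that the gradient at time [k] has not vanished; after the stop
    the step-size is frozen and need not obey the formula. *)
Context (a_bb : forall k i, w k i != 0 ->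
  a k.+1 = (\sum_j lam j * w k j ^+ 2) / (\sum_j lam j ^+ 2 * w k j ^+ 2)).

Let theta := 1 - L / U.

Let lam_gt0 i : 0 < lam i.
Proof. by case/andP: (lam_bnd i) => /(lt_le_trans L_gt0). Qed.

Lemma energy_gt0 k i : w k i != 0 -> 0 < \sum_j lam j ^+ 2 * w k j ^+ 2.
Proof.
move=> wi; rewrite (bigD1 i) //= ltr_wpDr //.
  by apply: sumr_ge0 => j _; rewrite mulr_ge0 // sqr_ge0.
by rewrite mulr_gt0 ?exprn_gt0 // lt_def wi w_ge0.
Qed.

(** Numerator and denominator of [a k.+1] are compared term by term, using
    [L * lam j <= lam j ^+ 2 <= U * lam j]. *)
Lemma inverse_step_bounds k i : w k i != 0 -> L * a k.+1 <= 1 <= U * a k.+1.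
Proof.
move=> wi; have D_gt0 := energy_gt0 wi; rewrite (a_bb wi) !mulrA.
rewrite ler_pdivrMr // ler_pdivlMr // !mul1r !mulr_sumr.
apply/andP; split; apply: ler_sum => j _; have /andP[Lj Uj] := lam_bnd j;
  rewrite mulrA ler_wpM2r ?sqr_ge0 // expr2 ler_wpM2r // ltW //.
Qed.

Lemma rate_bounds (i : I) : 0 <= theta < 1.
Proof.
have /andP[Li Ui] := lam_bnd i; have U_gt0 := lt_le_trans (lam_gt0 i) Ui.
rewrite /theta subr_ge0 ler_pdivrMr // mul1r (le_trans Li Ui) /=.
by rewrite gtrBl divr_gt0.
Qed.

(* [theta] bounds [1 - a k.+1 * lam i] from above because [a k.+1 >= U^-1]; the
   hypothesis makes [(a k.+1)^-1], a weighted mean of the [lam j], at least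
   [lam i / (1 + theta)], which bounds it from below. *)
Lemma contraction k i : w k i != 0 ->
  \sum_(j | lam j < lam i) lam j * w k j ^+ 2 <= theta * (lam i * w k i ^+ 2) ->
  `|1 - a k.+1 * lam i| <= theta.
Proof.
move=> wi; have D_gt0 := energy_gt0 wi.
set E := \sum_(j | _) _ => E_le.
have /andP[th_ge0 _] := rate_bounds i.
have /andP[_ Ua] := inverse_step_bounds wi.
have /andP[Li Ui] := lam_bnd i; have U_gt0 := lt_le_trans (lam_gt0 i) Ui.
pose S := \sum_(j | ~~ (lam j < lam i)) lam j * w k j ^+ 2.
have S_ge : lam i * w k i ^+ 2 <= S.
  rewrite /S (bigD1 i) ?ltxx //= lerDl; apply: sumr_ge0 => j _.
  by rewrite mulr_ge0 ?sqr_ge0 // ltW.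
have ES : E <= theta * S by rewrite (le_trans E_le) // ler_wpM2l.
(* The numerator of [a k.+1] is [E + S <= (1 + theta) * S]; the denominator is at least [lam i * S],
   since [S] collects eigenvalues no smaller than [lam i]. *)
have a_le : a k.+1 * lam i <= 1 + theta.
  rewrite (a_bb wi) (bigID (fun j => lam j < lam i)) /= -/E -/S.
  rewrite mulrAC ler_pdivrMr //.
  have D_ge : lam i * S <= \sum_j lam j ^+ 2 * w k j ^+ 2.
    rewrite [leRHS](bigID (fun j => lam j < lam i)) /= /S mulr_sumr.
    rewrite ler_wpDl //.
      by apply: sumr_ge0 => j _; rewrite mulr_ge0 // sqr_ge0.
    apply: ler_sum => j; rewrite -leNgt => le_ij.
    by rewrite mulrA ler_wpM2r ?sqr_ge0 // expr2 ler_wpM2r // ltW.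
  apply: le_trans (_ : (1 + theta) * (lam i * S) <= _); last first.
    by rewrite ler_wpM2l // addr_ge0.
  rewrite mulrC mulrCA ler_wpM2l ?(ltW (lam_gt0 i)) // mulrDl mul1r.
  by rewrite addrC lerD2l.
have a_ge : L / U <= a k.+1 * lam i.
  have a_ge1 : U^-1 <= a k.+1 by rewrite -[U^-1]mul1r ler_pdivrMr // mulrC.
  by rewrite [leLHS]mulrC ler_pM // ?invr_ge0 ltW.
rewrite ler_norml; apply/andP.
by split; move: a_le a_ge; rewrite /theta; lra.
Qed.

(** Later step-sizes are at most [L^-1], giving the factor [1 + U / L]; the arbitrary initial
    step-size [a 0] accounts for the last term of the witness. *)
Lemma growth_bound i : exists2 B, 0 < B & forall k, w k.+1 i <= B * w k i.
Proof.
have /andP[Li Ui] := lam_bnd i; have U_gt0 := lt_le_trans (lam_gt0 i) Ui.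
have UL_ge0 : 0 <= U / L by rewrite divr_ge0 // ltW.
have aU_ge0 : 0 <= `|a 0%N| * U by rewrite mulr_ge0 // ltW.
exists (1 + U / L + `|a 0%N| * U); first by rewrite ltr_wpDr // ltr_wpDr.
case=> [|k]; rewrite w_step.
  rewrite ler_wpM2r // (le_trans (ler_normB _ _)) // normr1 normrM.
  rewrite -addrA lerD2l ler_wpDl // ler_wpM2l // ger0_norm //.
  exact: ltW (lam_gt0 i).
have [wk0|wk_neq0] := eqVneq (w k i) 0; first by rewrite w_step wk0 !mulr0.
have /andP[aL aU] := inverse_step_bounds wk_neq0.
have a_gt0 : 0 < a k.+1 by rewrite -(pmulr_rgt0 _ U_gt0) (lt_le_trans ltr01).
rewrite ler_wpM2r // ler_wpDr // (le_trans (ler_normB _ _)) // normr1 lerD2l.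
rewrite ger0_norm ?mulr_ge0 ?(ltW a_gt0) ?(ltW (lam_gt0 i)) // mulrC.
rewrite ler_pM ?(ltW a_gt0) ?(ltW (lam_gt0 i)) // -[L^-1]mul1r.
by rewrite ler_pdivlMr // mulrC.
Qed.

(* If [w k i] exceeds [M * theta ^+ k], the step from [k.+1] to [k.+2] contracts
   mode [i] by [theta]; otherwise two steps of growth at most [B] cost the factor
   [(B / theta) ^+ 2]. *)
Lemma mode_decay_step i c : 0 < theta -> 0 <= c ->
  (forall k,
     \sum_(j | lam j < lam i) lam j * w k j ^+ 2 <= (c * theta ^+ k) ^+ 2) ->
  exists2 C, 0 < C & forall k, w k i <= C * theta ^+ k.
Proof.
move=> th_gt0 c_ge0 E_le; have [B B_gt0 wB] := growth_bound i.
have th0 : theta != 0 by rewrite gt_eqF.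
(* Both [d] and [theta * lam i * d] are at least 1, so [theta * lam i * d ^+ 2 >= 1]: this makes [M]
   large enough for [contraction] without a square root. *)
pose d := 1 + (theta * lam i)^-1.
pose M := c * d.
have thl_gt0 : 0 < theta * lam i by rewrite mulr_gt0.
have d_gt1 : 1 < d by rewrite ltrDl invr_gt0.
have M_ge0 : 0 <= M by rewrite mulr_ge0 // ltW // (lt_trans ltr01).
have cM : c ^+ 2 <= theta * lam i * M ^+ 2.
  rewrite /M exprMn mulrCA ler_peMr ?sqr_ge0 //.
  have dt : 1 <= theta * lam i * d.
    by rewrite /d mulrDr mulr1 mulfV ?gt_eqF // lerDr ltW.
  rewrite expr2 mulrA (le_trans (ltW d_gt1)) // ler_peMl //.
  by rewrite (le_trans ler01) // ltW.
(* The summands serve, in order, positivity, [k = 0], [k = 1], and the case of a small mode two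
   steps earlier. *)
pose C := 1 + w 0%N i + w 1%N i / theta + B ^+ 2 * M / theta ^+ 2.
have t1 : 0 <= w 1%N i / theta by rewrite divr_ge0 // ltW.
have t2 : 0 <= B ^+ 2 * M / theta ^+ 2.
  by apply: divr_ge0; rewrite ?sqr_ge0 // mulr_ge0 ?sqr_ge0.
have t0 := w_ge0 0 i.
exists C; first by rewrite /C; lra.
elim/ltn_ind => -[|[|k]] IH.
- by rewrite expr0 mulr1 /C; lra.
- rewrite expr1 -ler_pdivrMr // /C; lra.
have [wM|wM] := leP (w k i) (M * theta ^+ k).
  apply: le_trans (wB _) _; apply: le_trans (_ : B * (B * (M * theta ^+ k)) <= _).
    by rewrite ler_pM2l // (le_trans (wB _)) // ler_pM2l.
  have -> : B * (B * (M * theta ^+ k)) = B ^+ 2 * M / theta ^+ 2 * theta ^+ k.+2.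
    by rewrite !exprSr expr0; field.
  by rewrite ler_wpM2r ?exprn_ge0 ?(ltW th_gt0) // /C; lra.
have wk_gt0 : 0 < w k i by rewrite (le_lt_trans _ wM) // mulr_ge0 // exprn_ge0 ?ltW.
have q_le : `|1 - a k.+1 * lam i| <= theta.
  apply: contraction; first by rewrite gt_eqF.
  apply: le_trans (E_le k) _; rewrite mulrA.
  apply: le_trans (_ : theta * lam i * (M * theta ^+ k) ^+ 2 <= _).
    by rewrite [in leRHS]exprMn exprMn [leRHS]mulrA ler_wpM2r ?sqr_ge0.
  rewrite ler_pM2l // ler_sqr ?nnegrE ?(ltW wM) //.
  by rewrite mulr_ge0 // exprn_ge0 // ltW.
rewrite w_step exprS mulrCA ler_pM // IH //.
Qed.

Lemma mode_decay_of_rate_gt0 i : 0 < theta ->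
  exists2 C, 0 < C & forall k, w k i <= C * theta ^+ k.
Proof.
move=> th_gt0; have [m] := ubnP #|[pred j | lam j < lam i]|.
elim: m i => // m IHm i le_m.
(* The implication sits under the existential so that [fin_all_exists] can choose constants for all
   [j] at once. *)
have IH j : exists C, lam j < lam i ->
    0 < C /\ forall k, w k j <= C * theta ^+ k.
  have [lt_ji|] := boolP (lam j < lam i); last by exists 0.
  have [|C C_gt0 wC] := IHm j; last by exists C.
  rewrite -ltnS (leq_trans _ le_m) // ltnS.
  apply: proper_card; apply/fintype.properP; split.
    by apply/fintype.subsetP => l; rewrite !inE => /lt_trans; apply.
  by exists j; rewrite !inE ?ltxx.
have [C C_le] := fin_all_exists IH.
pose c2 := \sum_(j | lam j < lam i) lam j * C j ^+ 2.
have c2_ge0 : 0 <= c2.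
  by apply: sumr_ge0 => j _; rewrite mulr_ge0 ?sqr_ge0 // ltW.
(* [c2 <= (1 + c2) ^+ 2] replaces taking the square root of [c2]. *)
apply: (@mode_decay_step i (1 + c2)) => //; first by rewrite addr_ge0.
move=> k; rewrite exprMn.
apply: le_trans (_ : c2 * (theta ^+ k) ^+ 2 <= _).
  rewrite /c2 mulr_suml; apply: ler_sum => j /C_le[C_gt0 wC].
  rewrite -mulrA ler_wpM2l ?(ltW (lam_gt0 j)) // -exprMn ler_sqr ?nnegrE //.
  by rewrite (le_trans _ (wC k)).
rewrite ler_wpM2r ?sqr_ge0 // sqrrD; have := sqr_ge0 c2; lra.
Qed.

Lemma mode_decay i :
  exists2 C, 0 < C & forall k, (2 <= k)%N -> w k i <= C * theta ^+ k.
Proof.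
have /andP[th_ge0 _] := rate_bounds i.
have [th0|th_neq0] := eqVneq theta 0; last first.
  have [|C C_gt0 wC] := @mode_decay_of_rate_gt0 i; first by rewrite lt_def th_neq0.
  by exists C.
(* Here [L = U], so no eigenvalue lies below [lam i] and [contraction] gives the factor 0, from the
   step with [a 1] on; hence [2 <= k]. *)
exists 1 => // -[|[|k]] // _; rewrite th0 expr0n mulr0 w_step.
have [wk0|wk_neq0] := eqVneq (w k i) 0; first by rewrite w_step wk0 !mulr0.
have := @contraction k i wk_neq0; rewrite th0 mul0r big_pred0 => [/(_ (lexx _))|j].
  by rewrite normr_le0 => /eqP ->; rewrite normr0 mul0r.
have /andP[Lj Uj] := lam_bnd j; have /andP[Li Ui] := lam_bnd i.
have U_gt0 := lt_le_trans (lam_gt0 i) Ui.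
have LU : L = U.
  apply: (mulIf (invr_neq0 (lt0r_neq0 U_gt0))); rewrite divff ?gt_eqF //.
  by move: th0; rewrite /theta; lra.
by apply/negbTE; rewrite -leNgt (le_trans Ui) // -LU.
Qed.
End ModeDecay.

(** * Spectral decomposition of a real symmetric matrix *)

(* [w i x] is the modulus of the [i]-th coordinate of [x] in a unitary eigenbasis
   of [H] over [R[i]]; only these real numbers are needed. *)
Lemma symmetric_spectral_moduli (R : realType) (n : nat) (H : 'M[R]_n) :
  H^T = H -> exists (lam : 'I_n -> R) (w : 'I_n -> 'cV[R]_n -> R),
  [/\ forall c, eigenvalue H c <-> exists i, lam i = c,
      forall i x, 0 <= w i x,
      forall i p q x, w i (p *: x + q *: (H *m x)) = `|p + q * lam i| * w i x,
      forall x, dot x x = \sum_i w i x ^+ 2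
    & forall x, dot x (H *m x) = \sum_i lam i * w i x ^+ 2].
Proof.
move=> Hsym; pose phi : {rmorphism R -> R[i]} := real_complex R.
pose Hc := map_mx phi H.
have Hherm : Hc \is hermsymmx.
  apply: realsym_hermsym.
    apply/is_hermitianmxP.
    by rewrite expr0 scale1r map_mx_id // /Hc map_trmx Hsym.
  by apply/mxOverP => i j; rewrite mxE complex_real.
have Hnormal := hermitian_normalmx Hherm.
have /orthomx_spectralP := Hnormal.
have := hermitian_spectral_diag_real Hherm.
have := spectral_unitarymx Hc.
move: (spectralmx Hc) (spectral_diag Hc) => P d Punit dreal Hc_eq.
have P_unit := unitarymx_unit Punit.
pose lam i := complex.Re (d 0 i).
have lamE i : phi (lam i) = d 0 i.
  by apply: RRe_real; move/mxOverP: dreal.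
pose z (x : 'cV[R]_n) := P *m map_mx phi x.
have zH (x : 'cV[R]_n) i : z (H *m x) i 0 = d 0 i * z x i 0.
  rewrite /z map_mxM -/Hc Hc_eq !mulmxA mulmxV // mul1mx -mulmxA.
  by rewrite mul_diag_mx mxE.
have PP : (map_mx Num.conj P)^T *m P = 1%:M.
  by rewrite map_trmx -(invmx_unitary Punit) mulVmx.
(* [P] is unitary, and conjugation fixes the real entries of [x]. *)
have zdot (x y : 'cV[R]_n) : phi (dot x y) = \sum_i (z x i 0)^* * z y i 0.
  have -> : \sum_i (z x i 0)^* * z y i 0 = ((map_mx Num.conj (z x))^T *m z y) 0 0.
    by rewrite mxE; apply: eq_bigr => i _; rewrite !mxE.
  rewrite /z map_mxM trmx_mul -mulmxA (mulmxA _ P).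
  rewrite PP mul1mx.
  rewrite /dot [in LHS]mxE [in RHS]mxE rmorph_sum; apply: eq_bigr => i _.
  rewrite !mxE rmorphM; congr (_ * _); symmetry.
  by apply/CrealP; rewrite complex_real.
pose w i x := complex.ComplexField.Normc.normc (z x i 0).
have wE i x : phi (w i x) = `|z x i 0| by [].
exists lam, w; split.
- move=> c; split.
    rewrite -(eigenvalue_map phi) -/Hc => /eigenvalueP[v vH v0].
    (* [u] is a row eigenvector of [diag_mx d], so any nonzero entry of it identifies the
       eigenvalue. *)
    pose u := v *m invmx P.
    have u0 : u != 0.
      by apply: contra_neq v0 => u0; rewrite -(mulmxKV P_unit v) -/u u0 mul0mx.
    have ud : u *m diag_mx d = phi c *: u.
      have := congr1 (mulmx^~ (invmx P)) vH.
      by rewrite Hc_eq !mulmxA mulmxK // -scalemxAl.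
    clearbody u; have [i ui] : exists i, u 0 i != 0.
      by move/rV0Pn: u0.
    exists i; apply: complexI; rewrite -/phi lamE.
    have /rowP/(_ i) := ud.
    by rewrite mul_mx_diag !mxE mulrC => /(mulIf ui)->.
  move=> [i <-]; rewrite -(eigenvalue_map phi) -/Hc lamE.
  apply/eigenvalueP; exists (row i P).
    rewrite Hc_eq !mulmxA -row_mul mulmxV // row1 -rowE row_diag_mx.
    by rewrite -scalemxAl -rowE.
  apply/eqP => /(congr1 (mulmx^~ (invmx P))).
  rewrite mul0mx -row_mul mulmxV // row1 => /rowP/(_ i)/eqP.
  by rewrite !mxE !eqxx oner_eq0.
- by move=> i x; rewrite /w; case: (z x i 0) => u v; apply: sqrtr_ge0.
- move=> i p q x; apply: complexI; rewrite rmorphM -/phi !wE.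
  have -> : z (p *: x + q *: (H *m x)) i 0 = phi (p + q * lam i) * z x i 0.
    rewrite rmorphD rmorphM -/phi lamE mulrDl -mulrA -zH.
    by rewrite /z map_mxD !map_mxZ mulmxDr -!scalemxAr !mxE.
  by rewrite normrM normc_def /= expr0n addr0 sqrtr_sqr.
- move=> x; apply: complexI; rewrite -/phi zdot rmorph_sum.
  apply: eq_bigr => i _.
  by rewrite rmorphXn /= -/phi wE mulrC normCK.
- move=> x; apply: complexI; rewrite -/phi zdot rmorph_sum.
  apply: eq_bigr => i _.
  rewrite rmorphM rmorphXn /= -/phi wE lamE zH.
  by rewrite mulrCA [X in _ * X]mulrC normCK.
Qed.

(** * The quadratic model and its two step-sizes *)

Section QuadraticModel.
Context {R : realType} {n : nat}.
Implicit Types (H : 'M[R]_n) (b x y s : 'cV[R]_n) (alpha : R).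

Lemma dotC x y : dot x y = dot y x.
Proof. by rewrite /dot -[x^T *m y]trmxK trmx_mul trmxK mxE. Qed.

Lemma dotDl x y s : dot (x + y) s = dot x s + dot y s.
Proof. by rewrite /dot linearD mulmxDl mxE. Qed.

Lemma dotDr x y s : dot s (x + y) = dot s x + dot s y.
Proof. by rewrite !(dotC s) dotDl. Qed.

Lemma dotZl c x y : dot (c *: x) y = c * dot x y.
Proof. by rewrite /dot linearZ -scalemxAl mxE. Qed.

Lemma dotZr c x y : dot x (c *: y) = c * dot x y.
Proof. by rewrite !(dotC x) dotZl. Qed.

Lemma dot0r x : dot x 0 = 0.
Proof. by rewrite /dot mulmx0 mxE. Qed.

Lemma dot_sym H x y : H^T = H -> dot (H *m x) y = dot x (H *m y).
Proof. by move=> Hsym; rewrite /dot trmx_mul Hsym mulmxA. Qed.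

Lemma dotxx x : dot x x = \sum_i x i 0 ^+ 2.
Proof. by rewrite /dot mxE; apply: eq_bigr => i _; rewrite mxE. Qed.

Lemma dotxx_ge0 x : 0 <= dot x x.
Proof. by rewrite dotxx sumr_ge0 // => i _; rewrite sqr_ge0. Qed.

Lemma norm2_sqr x : norm2 x ^+ 2 = dot x x.
Proof. by rewrite /norm2 -dotxx sqr_sqrtr ?dotxx_ge0. Qed.

Lemma gradD H b x s : grad H b (x + s) = grad H b x + H *m s.
Proof. by rewrite /grad mulmxDr addrAC. Qed.

Lemma quadD H b x s : H^T = H ->
  quad H b (x + s) = quad H b x + dot s (grad H b x) + 2^-1 * dot s (H *m s).
Proof.
move=> Hsym; rewrite /quad /grad mulmxDr !dotDr !dotDl (dotC b s).
by rewrite -(dot_sym x s) // (dotC (H *m x)); field.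
Qed.

(** The linear term in the expansion of [quad] cancels [alpha * norm2 (grad H b x) ^+ 2], which
    leaves [s^T H s = s^T y]. The denominators coincide, so the equality holds even where they
    vanish. *)
Lemma kgd_bb_short H b x alpha : H^T = H ->
  let xnew := x - alpha *: grad H b x in
  kgd_short H b xnew x alpha = bb_short H b xnew x alpha.
Proof.
move=> Hsym /=; rewrite /kgd_short /bb_short quadD // gradD.
rewrite !norm2_sqr -!scaleNr !(addrC x) !addrK !(addrC (grad H b x)) addrK.
congr (_ / _); rewrite -scalemxAr !dotZl !dotZr; lra.
Qed.

Lemma bb_short_grad H b x alpha : alpha != 0 ->
  let g := grad H b x in
  bb_short H b (x - alpha *: g) x alpha =
    dot g (H *m g) / dot (H *m g) (H *m g).
Proof.
move=> a0 /=; rewrite /bb_short gradD -!scaleNr !(addrC x) addrK.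
rewrite !(addrC (grad H b x)) addrK -scalemxAr !dotZl !dotZr !mulrA.
by rewrite -mulf_div divff ?mul1r // mulf_neq0 // oppr_eq0.
Qed.

Lemma gd_seq_kgd_bb H b x alpha k : H^T = H ->
  gd_seq H b (kgd_short H b) x alpha k = gd_seq H b (bb_short H b) x alpha k.
Proof.
move=> Hsym; rewrite /gd_seq; congr (_.1); apply: eq_iter => -[y c] /=.
by rewrite kgd_bb_short.
Qed.

(** * Positive definiteness: minimizer and spectral bounds *)

Lemma posdefmx_unit H : posdefmx H -> H \in unitmx.
Proof.
case=> Hsym Hpos; rewrite -row_free_unit; apply: inj_row_free => v vH.
apply/eqP/negPn/negP => v0.
have := Hpos v^T; rewrite -trmx0 (inj_eq trmx_inj) => /(_ v0).
by rewrite -[in H *m _]Hsym -trmx_mul vH trmx0 dot0r ltxx.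
Qed.

Lemma posdefmx_dot_ge0 H x : posdefmx H -> 0 <= dot x (H *m x).
Proof.
case=> _ Hpos; have [->|/Hpos/ltW//] := eqVneq x 0.
by rewrite mulmx0 dot0r.
Qed.

Lemma grad_center H b x : posdefmx H ->
  grad H b x = H *m (x + invmx H *m b).
Proof. by move=> /posdefmx_unit Hu; rewrite mulmxDr mulKVmx. Qed.

Lemma is_minimizer_quad H b z : posdefmx H ->
  is_minimizer (quad H b) z <-> z = - (invmx H *m b).
Proof.
move=> Hpd; set xs := - _; have [Hsym Hpos] := Hpd.
have gs : grad H b xs = 0 by rewrite grad_center // addNr mulmx0.
have quadE y : quad H b y = quad H b xs + 2^-1 * dot (y - xs) (H *m (y - xs)).
  by rewrite -{1}(subrK xs y) addrC quadD // gs dot0r addr0.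
split=> [zmin|-> y]; last by rewrite (quadE y) lerDl mulr_ge0 ?posdefmx_dot_ge0.
apply/eqP; rewrite -subr_eq0; apply/negPn/negP => /Hpos d_gt0.
have := zmin xs; rewrite (quadE z) leNgt => /negP; apply.
by rewrite ltrDl mulr_gt0 ?invr_gt0.
Qed.

Lemma posdefmx_eigenvalue_gt0 H c : posdefmx H -> eigenvalue H c -> 0 < c.
Proof.
move=> [Hsym Hpos] /eigenvalueP[v vH v0].
have := Hpos v^T; rewrite -trmx0 (inj_eq trmx_inj) => /(_ v0).
rewrite -[in H *m _]Hsym -trmx_mul vH linearZ dotZr.
have := dotxx_ge0 v^T; rewrite le_eqVlt => /predU1P[<-|v_gt0].
  by rewrite mulr0 ltxx.
by rewrite pmulr_lgt0.
Qed.

(** Allows the bounds on single modes to be added up to a bound on the norm. *)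
Lemma norm2_le_sum (c : 'I_n -> R) x : (forall i, 0 <= c i) ->
  dot x x = \sum_i c i ^+ 2 -> norm2 x <= \sum_i c i.
Proof.
move=> c_ge0 xc; have S_ge0 : 0 <= \sum_i c i by apply: sumr_ge0.
rewrite -ler_sqr ?nnegrE ?sqrtr_ge0 // norm2_sqr xc expr2 mulr_suml.
apply: ler_sum => i _; rewrite expr2 ler_wpM2l // (bigD1 i) //= lerDl.
by apply: sumr_ge0.
Qed.

Lemma lambda_bounds H (lam : 'I_n -> R) : (0 < n)%N -> posdefmx H ->
  (forall c, eigenvalue H c <-> exists i, lam i = c) ->
  0 < lambda_min H /\ forall i, lambda_min H <= lam i <= lambda_max H.
Proof.
move=> n_gt0 Hpd lamE; have eig i : eigenvalue H (lam i) by apply/lamE; exists i.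
pose i0 := Ordinal n_gt0.
have lam_gt0 i : 0 < lam i := posdefmx_eigenvalue_gt0 Hpd (eig i).
split.
  (* Positivity of the infimum needs one positive lower bound: the least [lam i]. *)
  have [i _ i_min] := @Order.TotalTheory.arg_minP _ _ _ i0 xpredT lam isT.
  apply: lt_le_trans (lam_gt0 i) _; apply: lb_le_inf.
    by exists (lam i); apply: eig.
  by move=> _ /lamE[j <-]; apply: i_min.
have lb : has_lbound [set c | eigenvalue H c].
  by exists 0 => _ /lamE[j <-]; exact: ltW.
have ub : has_ubound [set c | eigenvalue H c].
  exists (\sum_j lam j) => _ /lamE[j <-].
  by rewrite (bigD1 j) //= lerDl sumr_ge0 // => l _; exact: ltW.
by move=> i; rewrite (ge_inf lb (eig i)) (ub_le_sup ub (eig i)).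
Qed.

(** * Convergence of the iteration *)

Lemma cvg_Rlinear_of_bound (x : nat -> 'cV[R]_n) xs (rho C : R) k0 :
  0 <= rho < 1 -> 0 < C ->
  (forall k, (k0 <= k)%N -> norm2 (x k - xs) <= C * rho ^+ k) ->
  cvg_Rlinear x xs rho.
Proof.
move=> /andP[rho_ge0 rho_lt1] C_gt0 xC; split.
- by rewrite rho_ge0.
- have cvg0 : (fun k => C * rho ^+ k) @ \oo --> (0 : R).
    rewrite -[0 in X in _ --> X](mulr0 C); apply: cvgMr.
    by apply: cvg_expr; rewrite ger0_norm.
  apply: squeeze_cvgr (cvg_cst 0) cvg0; near=> k.
  rewrite sqrtr_ge0 xC //; near: k; exact: nbhs_infty_ge.
- by exists C; split => //; exists k0.
Unshelve. all: by end_near. Qed.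

(** Provides the nonzero step-size by which [bb_short_grad] cancels [alpha ^+ 2]. *)
Lemma bb_stepsize_gt0 H b x alpha k : posdefmx H -> 0 < alpha ->
  0 < (iter k (gd_step H b (bb_short H b)) (x, alpha)).2.
Proof.
move=> Hpd alpha_gt0; elim: k => //= k.
case: (iter k _ _) => y c /= c_gt0.
have [//|g0] := eqVneq (grad H b y) 0.
have [_ Hpos] := Hpd.
rewrite bb_short_grad ?gt_eqF //= divr_gt0 ?Hpos //.
have Hg0 : H *m grad H b y != 0.
  apply: contra_neq g0 => Hg.
  by rewrite -(mulKmx (posdefmx_unit Hpd) (grad H b y)) Hg mulmx0.
rewrite lt_def dotxx_ge0 andbT dotxx psumr_eq0 => [|i _]; last exact: sqr_ge0.
apply: contra Hg0 => /allP /= Hg; apply/eqP/colP => i; rewrite [RHS]mxE.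
by apply/eqP; rewrite -sqrf_eq0; apply: Hg; rewrite mem_index_enum.
Qed.

Lemma bb_Rlinear H b x0 alpha0 : (0 < n)%N -> posdefmx H -> 0 < alpha0 ->
  cvg_Rlinear (gd_seq H b (bb_short H b) x0 alpha0)
    (- (invmx H *m b)) (1 - (cond_number H)^-1).
Proof.
move=> n_gt0 Hpd alpha0_gt0; have [Hsym Hpos] := Hpd.
have [lam [w [lamE w_ge0 wZ w_dot w_dotH]]] := symmetric_spectral_moduli Hsym.
have [L_gt0 lam_bnd] := lambda_bounds n_gt0 Hpd lamE.
rewrite /cond_number invf_div; set L := lambda_min H in L_gt0 lam_bnd *.
set U := lambda_max H in lam_bnd *.
have wH i y : w i (H *m y) = lam i * w i y.
  rewrite -[H *m y]add0r -(scale0r y) -[H *m y]scale1r wZ add0r mul1r ger0_norm //.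
  by have /andP[/(lt_le_trans L_gt0)/ltW] := lam_bnd i.
have w0 i : w i 0 = 0.
  by have := wZ i 0 0 0; rewrite mulmx0 scaler0 mul0r !addr0 normr0 mul0r.
pose st k := iter k (gd_step H b (bb_short H b)) (x0, alpha0).
pose g k := grad H b (st k).1.
have st_gt0 k : 0 < (st k).2 by apply: bb_stepsize_gt0.
(* After the stop both sides are 0, so the recursion holds for every [k]. *)
have W_step k i : w i (g k.+1) = `|1 - (st k).2 * lam i| * w i (g k).
  rewrite /g /st /= -/(st k); case: (st k) => y c /=.
  have [gy0|_] := eqVneq (grad H b y) 0; first by rewrite gy0 w0 mulr0.
  by rewrite gradD -scaleNr -scalemxAr -[X in X + _]scale1r wZ mulNr.
have a_bb k i : w i (g k) != 0 -> (st k.+1).2 =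
    (\sum_j lam j * w j (g k) ^+ 2) / (\sum_j lam j ^+ 2 * w j (g k) ^+ 2).
  move=> wi; have g0 : g k != 0 by apply: contra_neq wi => ->.
  rewrite -w_dotH; under eq_bigr do rewrite -exprMn -wH.
  rewrite -w_dot; move: g0 (st_gt0 k); rewrite /g /st /= -/(st k).
  case: (st k) => y c /= /negPf -> c_gt0.
  by rewrite bb_short_grad // gt_eqF.
have decay i : exists C, 0 < C /\
    forall k, (2 <= k)%N -> w i (g k) <= C * (1 - L / U) ^+ k.
  have w_g_ge0 k j : 0 <= w j (g k) by [].
  have [C C_gt0 wC] := mode_decay L_gt0 lam_bnd w_g_ge0 W_step a_bb i.
  by exists C.
have [C C_P] := fin_all_exists decay.
pose i0 := Ordinal n_gt0.
(* The gradient is [H] applied to the error, so mode [i] of the error is that of the gradient over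
   [lam i >= L]; the start 2 comes from [mode_decay]. *)
apply: (@cvg_Rlinear_of_bound _ _ _ ((\sum_i C i) / L) 2).
- exact: rate_bounds L_gt0 lam_bnd i0.
- rewrite divr_gt0 // (bigD1 i0) //= ltr_pwDl ?(C_P i0).1 //.
  by apply: sumr_ge0 => i _; exact: ltW (C_P i).1.
move=> k k_ge2; rewrite opprK.
apply: le_trans (norm2_le_sum (fun i => w_ge0 i _) (w_dot _)) _.
rewrite !mulr_suml; apply: ler_sum => i _.
rewrite mulrAC ler_pdivlMr //.
apply: le_trans ((C_P i).2 k k_ge2); rewrite /g grad_center // wH mulrC.
by rewrite ler_wpM2r //; case/andP: (lam_bnd i).
Qed.
End QuadraticModel.

Theorem theorem3p2 (R : realType) (n : nat) (n_gt0 : (0 < n)%N)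
    (H : 'M[R]_n) (b : 'cV[R]_n) (H_posdef : posdefmx H)
    (x0 : 'cV[R]_n) (alpha0 : R) (alpha0_gt0 : 0 < alpha0) :
  (forall k : nat,
     gd_seq H b (kgd_short H b) x0 alpha0 k =
     gd_seq H b (bb_short H b) x0 alpha0 k) /\
  (forall z : 'cV[R]_n,
     is_minimizer (quad H b) z <-> z = - (invmx H *m b)) /\
  cvg_Rlinear (gd_seq H b (kgd_short H b) x0 alpha0)
    (- (invmx H *m b)) (1 - (cond_number H)^-1).
Proof.
have Hsym := H_posdef.1; split; first by move=> k; exact: gd_seq_kgd_bb.
split; first by move=> z; exact: is_minimizer_quad.
have -> : gd_seq H b (kgd_short H b) x0 alpha0 =
    gd_seq H b (bb_short H b) x0 alpha0.
  by apply/funext => k; exact: gd_seq_kgd_bb.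
exact: bb_Rlinear.
Qed.
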